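(* Let $(\mathbb{K},|\cdot|)$ be an algebraically closed normed field, let $f\in\mathbb{K}[z]$ be a polynomial of degree $n\ge 2$, let $N\ge 1$ be an integer and let $1\le p\le\infty$. Suppose $x^{(0)}\in\mathbb{K}^n$ is a vector with pairwise distinct components such that \[ E_f(x^{(0)})\le \frac{1}{(1+\sqrt{a})^2}\quad\text{and}\quad \Omega(E_f(x^{(0)}))<2, \] where $a=(n-1)^{1/q}$. In the case $n=2$ and $p=\infty$ assume moreover that the first inequality is strict. Then $f$ has only simple zeros in $\mathbb{K}$, and the $N$th Weierstrass-type iteration $x^{(k+1)}=T^{(N)}(x^{(k)})$ starting from $x^{(0)}$ is well-defined and converges to a root-vector $\xi$ of $f$ with order of convergence $N+1$, and the error estimate \[ \|x^{(k)}-\xi\|\preceq \alpha(E_f(x^{(k)}))\,\|W_f(x^{(k)})\| \] holds for every $k\ge 0$ such that $E_f(x^{(k)})\le 1/(1+\sqrt{a})^2$ and $\Omega(E_f(x^{(k)}))<2$.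
   Context: $(\mathbb{K},|\cdot|)$ is an algebraically closed normed field and $a_0$ denotes the leading coefficient of $f$. For $1\le p\le\infty$, $\|x\|_p=(\sum_{i=1}^n|x_i|^p)^{1/p}$ (with $\|x\|_\infty=\max_i|x_i|$), and $q\in[1,\infty]$ is the conjugate exponent, $1/p+1/q=1$. For $x\in\mathbb{K}^n$, $\|x\|=(|x_1|,\dots,|x_n|)\in\mathbb{R}^n$, and $\preceq$ is the coordinatewise order on $\mathbb{R}^n$ ($u\preceq v$ iff $u_i\le v_i$ for all $i$). For $x\in\mathbb{K}^n$, $d(x)=(d_1(x),\dots,d_n(x))$ with $d_i(x)=\min_{j\ne i}|x_i-x_j|$; for $x\in\mathbb{K}^n$ and $y\in\mathbb{R}^n$ with nonzero components, $x/y=(|x_1|/y_1,\dots,|x_n|/y_n)\in\mathbb{R}^n$. A vector $\xi\in\mathbb{K}^n$ is a root-vector of $f$ if $f(z)=a_0\prod_{i=1}^n(z-\xi_i)$ for all $z\in\mathbb{K}$. Weierstrass correction: for $x$ with distinct components, $W_f(x)=(W_1(x),\dots,W_n(x))$ with $W_i(x)=f(x_i)/\big(a_0\prod_{j\ne i}(x_i-x_j)\big)$, and $E_f(x)=\|W_f(x)/d(x)\|_p$. Weierstrass-type maps: $T^{(0)}(x)=x$ on $D_0=\mathbb{K}^n$; recursively, $D_{N+1}=\{x\in D_N : x_i\ne T^{(N)}_j(x)\text{ for all } i\ne j\}$ and, for $x\in D_{N+1}$ and $i=1,\dots,n$, $T^{(N+1)}_i(x)=x_i-\dfrac{f(x_i)}{a_0\prod_{j\ne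 i}(x_i-T^{(N)}_j(x))}$. The iteration $x^{(k+1)}=T^{(N)}(x^{(k)})$ is well-defined if $x^{(k)}\in D_N$ for all $k\ge0$. Real functions: $\Psi(t)=(1+2t)\left(1+\frac{t}{(n-1)^{1/p}}\right)^{n-1}$ for $t\ge0$ (where $(n-1)^{1/p}=1$ if $p=\infty$); $\alpha(t)=\dfrac{2}{1-(a-1)t+\sqrt{(1-(a-1)t)^2-4t}}$; $h(t)=t\,\alpha(t)$; $\Omega(t)=\Psi(h(t))$. *)

(* Defs.v *)
From HB Require Import structures.
From mathcomp Require Import all_boot all_order all_algebra.
From mathcomp Require Import all_classical all_reals.
From mathcomp Require Import ereal exp.
Set Implicit Arguments. Unset Strict Implicit. Unset Printing Implicit Defensive.
Import Order.TTheory GRing.Theory Num.Theory.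
Local Open Scope ring_scope.

Definition is_absval (K : fieldType) (R : realType) (abs : K -> R) : Prop :=
  [/\ forall x, 0 <= abs x,
      forall x, abs x = 0 <-> x = 0,
      forall x y, abs (x * y) = abs x * abs y
    & forall x y, abs (x + y) <= abs x + abs y].

Section Defs.
Variables (R : realType) (K : fieldType) (abs : K -> R) (n : nat).

Definition invp (p : \bar R) : R := if p is r%:E then r^-1 else 0.

Definition pnorm (p : \bar R) (v : 'I_n -> R) : R :=
  if p is r%:E then (\sum_(i < n) v i `^ r) `^ r^-1
  else \big[Num.max/0]_(i < n) v i.

Definition cnorm (x : 'I_n -> K) : 'I_n -> R := fun i => abs (x i).

Definition cle (u v : 'I_n -> R) : Prop := forall i, u i <= v i.

Definition dvec (x : 'I_n -> K) : 'I_n -> R := fun i =>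
  fine (\big[Order.min/+oo%E]_(j < n | j != i) (abs (x i - x j))%:E).

Definition Wcorr (f : {poly K}) (x : 'I_n -> K) : 'I_n -> K := fun i =>
  f.[x i] / (lead_coef f * \prod_(j < n | j != i) (x i - x j)).

Definition Ef (p : \bar R) (f : {poly K}) (x : 'I_n -> K) : R :=
  pnorm p (fun i => abs (Wcorr f x i) / dvec x i).

(* Weierstrass-type maps T^(N) (total functions; meaningful on D_N) *)
Fixpoint Tmap (f : {poly K}) (N : nat) : ('I_n -> K) -> ('I_n -> K) :=
  match N with
  | 0 => fun x => x
  | N'.+1 => fun x i =>
      x i - f.[x i] / (lead_coef f * \prod_(j < n | j != i) (x i - Tmap f N' x j))
  end.

Fixpoint Dom (f : {poly K}) (N : nat) : ('I_n -> K) -> Prop :=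
  match N with
  | 0 => fun _ => True
  | N'.+1 => fun x => Dom f N' x /\ forall i j : 'I_n, i != j -> x i != Tmap f N' x j
  end.

Definition iterW (f : {poly K}) (N : nat) (x0 : 'I_n -> K) (k : nat) : 'I_n -> K :=
  iter k (Tmap f N) x0.

Definition root_vector (f : {poly K}) (xi : 'I_n -> K) : Prop :=
  forall z : K, f.[z] = lead_coef f * \prod_(i < n) (z - xi i).

Definition Psi (p : \bar R) (t : R) : R :=
  (1 + 2 * t) * (1 + t / (n.-1)%:R `^ invp p) ^+ n.-1.

Definition alphaf (a t : R) : R :=
  2 / (1 - (a - 1) * t + Num.sqrt ((1 - (a - 1) * t) ^+ 2 - 4 * t)).

Definition hf (a t : R) : R := t * alphaf a t.

Definition Omega (p : \bar R) (a t : R) : R := Psi p (hf a t).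

Definition maxnorm (x : 'I_n -> K) : R := \big[Num.max/0]_(i < n) abs (x i).

Definition vconverges (x : nat -> 'I_n -> K) (xi : 'I_n -> K) : Prop :=
  forall eps : R, 0 < eps -> exists k0 : nat, forall k, (k0 <= k)%N ->
    forall i, abs (x k i - xi i) < eps.

Definition conv_order (x : nat -> 'I_n -> K) (xi : 'I_n -> K) (r : nat) : Prop :=
  exists C : R, forall k : nat,
    maxnorm (fun i => x k.+1 i - xi i) <= C * maxnorm (fun i => x k i - xi i) ^+ r.

End Defs.

(* Main.v *)
(* Write W for the Weierstrass corrections of x, t for E_f(x), d for d(x), and
   h = h(t).  By Lagrange interpolation a zero z of f other than the nodes x_j,
   j <> i, is a fixed point of
     Phi_i(z) = x_i - W_i / (1 + sum_(j <> i) W_j / (z - x_j)),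
   and on the discs |z - x_i| <= u d_i Hölder's inequality shows that Phi_i is
   majorized by phi(u) = t / (1 - a t / (1 - u)), whose smallest fixed point is h.
   Hence |Phi_i(z_k) - z_k| gets arbitrarily small along the orbit of x_i, so does
   |f(z_k)|, and since f splits (no completeness is needed) f has a zero xi_i with
   |x_i - xi_i| <= h d_i; the fixed point equation sharpens this to alpha |W_i|.
   As Omega(t) < 2 forces h < 1/2, the discs are disjoint and carry all the zeros.

   For the iteration, T^(N+1)_i - xi_i = (x_i - xi_i) (1 - prod_(j <> i) (1 + u_j))
   with u_j = (T^(N)_j - xi_j) / (x_i - T^(N)_j).  If tau bounds the products
   prod_(j <> i) (1 + |x_j - xi_j| / d_j), then every T^(N) contracts the errors by
   tau - 1, and (1 + 2 h) tau < 2, that is Omega(t) < 2, makes this stable.  Each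
   stage multiplies the error by a quantity of the order of the previous error,
   hence the order N + 1. *)
Require Import Defs.
From HB Require Import structures.
From mathcomp Require Import all_boot all_order all_algebra.
From mathcomp Require Import all_classical all_reals.
From mathcomp Require Import ereal exp.
From mathcomp Require Import ring lra.
Import Order.TTheory GRing.Theory Num.Theory.
Set Implicit Arguments.
Unset Strict Implicit.
Unset Printing Implicit Defensive.
Local Open Scope ring_scope.

(** * Absolute values and perturbed products *)

Section AbsoluteValue.
Variables (R : realType) (K : fieldType) (abs : K -> R).
Hypothesis Habs : is_absval abs.

Lemma absv_ge0 x : 0 <= abs x. Proof. by case: Habs. Qed.

Lemma absv_eq0 x : (abs x == 0) = (x == 0).
Proof. by case: Habs => _ h _ _; apply/eqP/eqP => /h. Qed.

Lemma absv0 : abs 0 = 0. Proof. by apply/eqP; rewrite absv_eq0. Qed.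

Lemma absv_gt0 x : (0 < abs x) = (x != 0).
Proof. by rewrite lt0r absv_eq0 absv_ge0 andbT. Qed.

Lemma absvM x y : abs (x * y) = abs x * abs y. Proof. by case: Habs. Qed.

Lemma absvD x y : abs (x + y) <= abs x + abs y. Proof. by case: Habs. Qed.

Lemma absv1 : abs 1 = 1.
Proof.
apply: (@mulIf _ (abs 1)); first by rewrite absv_eq0 oner_eq0.
by rewrite -absvM !mul1r.
Qed.

Lemma absvN x : abs (- x) = abs x.
Proof.
apply/eqP; rewrite -(@eqrXn2 _ 2) ?absv_ge0//.
by rewrite !expr2 -!absvM mulrNN.
Qed.

Lemma absvB x y : abs (x - y) = abs (y - x).
Proof. by rewrite -absvN opprB. Qed.

Lemma absv_triangle y x z : abs (x - z) <= abs (x - y) + abs (y - z).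
Proof. by rewrite (le_trans _ (absvD _ _))// addrA subrK. Qed.

Lemma absvV x : abs x^-1 = (abs x)^-1.
Proof.
have [->|x0] := eqVneq x 0; first by rewrite invr0 absv0 invr0.
apply: (@mulIf _ (abs x)); first by rewrite absv_eq0.
by rewrite -absvM !mulVf ?absv1// absv_eq0.
Qed.

Lemma absv_prod (I : finType) (P : pred I) (F : I -> K) :
  abs (\prod_(i | P i) F i) = \prod_(i | P i) abs (F i).
Proof. by rewrite (big_morph _ absvM absv1). Qed.

Lemma absv_sum (I : finType) (P : pred I) (F : I -> K) :
  abs (\sum_(i | P i) F i) <= \sum_(i | P i) abs (F i).
Proof.
elim/big_ind2: _ => [|x a y b xa yb|//]; first by rewrite absv0.
exact: le_trans (absvD _ _) (lerD xa yb).
Qed.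

(** Expanding the product and removing the constant term leaves monomials in the [u i], each bounded
    termwise. The induction also carries the bound on the whole product, since x y - 1 = (x - 1) y +
    (y - 1). *)
Lemma absv_prod1D_sub1 (I : finType) (P : pred I) (u : I -> K) :
  abs (\prod_(i | P i) (1 + u i) - 1) <= \prod_(i | P i) (1 + abs (u i)) - 1.
Proof.
suff [] : abs (\prod_(i | P i) (1 + u i) - 1) <= \prod_(i | P i) (1 + abs (u i)) - 1
  /\ abs (\prod_(i | P i) (1 + u i)) <= \prod_(i | P i) (1 + abs (u i)) by [].
elim/big_ind2: _ => [|a x b y [x1 xa] [y1 yb]|i _].
- by rewrite !subrr absv0 absv1.
- have -> : x * y - 1 = (x - 1) * y + (y - 1) by rewrite mulrBl mul1r addrA subrK.
  have xa' : 0 <= a - 1 by apply: le_trans x1; exact: absv_ge0.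
  split; last by rewrite absvM ler_pM ?absv_ge0.
  apply: le_trans (absvD _ _) _; rewrite absvM.
  have := ler_pM (absv_ge0 (x - 1)) (absv_ge0 y) x1 yb.
  nra.
- by rewrite addrAC subrr add0r addrAC subrr add0r; split=> //; rewrite -absv1 absvD.
Qed.

End AbsoluteValue.

(** * Mean inequalities and Hölder's inequality for the p-norm *)

Lemma card_ord_neq n (i : 'I_n) : #|[pred j : 'I_n | j != i]| = n.-1.
Proof. by have := cardC1 i; rewrite card_ord. Qed.

Section PNorm.
Variables (R : realType) (n : nat).


(** Arithmetic-geometric mean inequality over the n - 1 indices other than [i]; [s] bounds the mean
    of the weights. *)
Lemma prod1D_le_mean (i : 'I_n) (w : 'I_n -> R) (s : R) :
  (forall j, 0 <= w j) -> \sum_(j < n | j != i) w j <= n.-1%:R * s ->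
  \prod_(j < n | j != i) (1 + w j) <= (1 + s) ^+ n.-1.
Proof.
move=> w0 ws.
have := leif_AGM (A := [pred j : 'I_n | j != i]) (E := fun j => 1 + w j).
rewrite card_ord_neq => /(_ _)[|h _]; first by move=> j _; rewrite addr_ge0.
apply: (le_trans h).
have [m0|m0] := posnP n.-1; first by rewrite m0 !expr0.
apply: lerXn2r.
- by rewrite nnegrE divr_ge0// sumr_ge0// => j _; rewrite addr_ge0.
- rewrite nnegrE addr_ge0//.
  rewrite -(@pmulr_rge0 _ n.-1%:R) ?ltr0n//; apply: le_trans ws; by apply: sumr_ge0 => j _.
rewrite ler_pdivrMr ?ltr0n// big_split/= sumr_const card_ord_neq mulrDl mul1r lerD2l.
by rewrite mulrC.
Qed.

Lemma ler_pnorm (p : \bar R) (v : 'I_n -> R) (i : 'I_n) :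
  (1 <= p)%E -> (forall j, 0 <= v j) -> v i <= pnorm p v.
Proof.
case: p => [r| |]//= p1 v0; last by apply: (@le_bigmax _ _ _ 0 _ i).
have r0 : 0 < r by rewrite (lt_le_trans ltr01).
have -> : v i = (v i `^ r) `^ r^-1 by rewrite -powRrM mulfV ?gt_eqF// powRr1.
apply: ge0_ler_powR; rewrite ?nnegrE ?invr_ge0 ?powR_ge0 ?(ltW r0)//.
  by apply: sumr_ge0 => j _; exact: powR_ge0.
by rewrite (bigD1 i)//= lerDl sumr_ge0// => j _; exact: powR_ge0.
Qed.

(** Hölder's inequality against the constant vector 1 on n - 1 indices, whose q-norm is the constant
    a. *)
Lemma sum_le_pnorm (p : \bar R) (v : 'I_n -> R) (i : 'I_n) :
  (2 <= n)%N -> (1 <= p)%E -> (forall j, 0 <= v j) ->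
  \sum_(j < n | j != i) v j <= n.-1%:R `^ (1 - invp p) * pnorm p v.
Proof.
move=> n2 p1 v0.
have m0 : (0 : R) < n.-1%:R by rewrite ltr0n; case: n n2 => [|[]].
case: p p1 => [r| |]//= p1; last first.
  rewrite subr0 powRr1 ?(ltW m0)// mulr_natl -(card_ord_neq i) -sumr_const.
  by apply: ler_sum => j _; exact: (@le_bigmax _ _ _ 0 _ j).
have r0 : 0 < r by rewrite (lt_le_trans ltr01).
set S := \sum_(j < n | _) _; set m := n.-1%:R : R in m0 *.
have S0 : 0 <= S by apply: sumr_ge0 => j _.
have key : m * (S / m) `^ r <= \sum_(j < n) v j `^ r.
  have [->|r1] := eqVneq r 1.
    rewrite powRr1 ?divr_ge0 ?(ltW m0)// mulrC divfK ?gt_eqF//.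
    rewrite (bigD1 i)//= powRr1//.
    rewrite /S (eq_bigr (fun j => v j `^ 1)) ?lerDr// => j _; by rewrite powRr1.
  have r1' : 1 < r by rewrite lt_neqAle eq_sym r1.
  set mu := S / m; set q := r / (r - 1).
  have mu0 : 0 <= mu by rewrite divr_ge0 ?(ltW m0).
  have q0 : 0 < q by rewrite divr_gt0 ?subr_gt0.
  have pq : r^-1 + q^-1 = 1 by rewrite /q; field; rewrite !gt_eqF ?subr_gt0.
  have hq : mu `^ (r - 1) `^ q = mu `^ r.
    by rewrite -powRrM /q mulrC divfK// gt_eqF ?subr_gt0.
  (* Young's inequality, with equality at v_j = mu. Summed over j, with m mu^r / q moved to the
     left, it gives the power mean inequality [key]. *)
  have young j : v j * mu `^ (r - 1) <= v j `^ r / r + mu `^ r / q.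
    by rewrite -hq; apply: conjugate_powR => //; exact: powR_ge0.
  have : \sum_(j < n | j != i) v j * mu `^ (r - 1) <=
         \sum_(j < n | j != i) (v j `^ r / r + mu `^ r / q).
    by apply: ler_sum.
  rewrite -mulr_suml big_split/= sumr_const card_ord_neq -mulr_suml -/S.
  have -> : S = m * mu by rewrite /mu mulrC divfK// gt_eqF.
  rewrite -mulrA mulr_powRB1// -[_ *+ _]mulr_natl -/m.
  have -> : q^-1 = 1 - r^-1 by rewrite -pq [r^-1 + _]addrC addrK.
  move=> h.
  have h2 : m * mu `^ r * r^-1 <= (\sum_(j < n | j != i) v j `^ r) * r^-1 by nra.
  rewrite (ler_pM2r _) ?invr_gt0// in h2.
  apply: (le_trans h2).
  by rewrite [leRHS](bigD1 i)//= lerDr powR_ge0.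
have -> : S = (m `^ (r - 1) * (m * (S / m) `^ r)) `^ r^-1.
  rewrite mulrA [_ * m]mulrC mulr_powRB1 ?(ltW m0)// -powRM ?divr_ge0 ?(ltW m0)//.
  by rewrite [m * _]mulrC divfK ?gt_eqF// -powRrM mulfV ?gt_eqF// powRr1.
have -> : m `^ (1 - r^-1) = (m `^ (r - 1)) `^ r^-1.
  by rewrite -powRrM; congr (_ `^ _); field; rewrite gt_eqF.
rewrite -powRM ?powR_ge0//; last by apply: sumr_ge0 => j _; exact: powR_ge0.
apply: ge0_ler_powR; rewrite ?nnegrE ?invr_ge0 ?mulr_ge0 ?powR_ge0 ?(ltW r0)//.
  by apply: sumr_ge0 => j _; exact: powR_ge0.
by rewrite ler_pM2l// powR_gt0.
Qed.

End PNorm.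

(** * The quadratic equation behind alpha *)

Lemma alphaf_root (R : realType) (a t : R) :
  1 <= a -> 0 <= t -> t <= 1 / (1 + Num.sqrt a) ^+ 2 ->
  0 < alphaf a t /\ t * alphaf a t ^+ 2 - (1 - (a - 1) * t) * alphaf a t + 1 = 0.
Proof.
move=> a1 t0; rewrite /alphaf; set s := Num.sqrt a; set b := 1 - _.
have s1 : 1 <= s by rewrite -sqrtr1 ler_wsqrtr.
have ass : a = s ^+ 2 by rewrite sqr_sqrtr// (le_trans ler01).
have s1p : 0 < 1 + s by lra.
rewrite ler_pdivlMr ?exprn_gt0// => tle.
(* Since a - 1 = (s - 1)(s + 1), the bound t (1 + s)^2 <= 1 gives b >= 2 / (1 + s) >= 2 sqrt t, so
   the discriminant b^2 - 4 t is nonnegative. *)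
have bs : (1 + s) * b >= 2.
  have : (s - 1) * (t * (1 + s) ^+ 2) <= (s - 1) * 1.
    by rewrite ler_wpM2l// subr_ge0.
  rewrite /b ass; nra.
have b0 : 0 < b by rewrite -(pmulr_rgt0 _ s1p) (lt_le_trans _ bs).
have disc : 0 <= b ^+ 2 - 4 * t.
  have h1 : 4 <= ((1 + s) * b) ^+ 2 by nra.
  have h2 : 0 <= (b ^+ 2 - 4 * t) * (1 + s) ^+ 2 by rewrite exprMn in h1; nra.
  by rewrite -(pmulr_lge0 _ (exprn_gt0 2 s1p)).
(* 2 / (b + q) is the smaller root (b - q) / (2 t) of t y^2 - b y + 1, rationalized so that it still
   makes sense at t = 0. *)
set q := Num.sqrt _; have q0 : 0 <= q := sqrtr_ge0 _.
have qq : q ^+ 2 = b ^+ 2 - 4 * t by rewrite sqr_sqrtr.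
have bq : 0 < b + q by lra.
split; first by rewrite divr_gt0.
have -> : t = (b ^+ 2 - q ^+ 2) / 4 by lra.
by field; rewrite gt_eqF.
Qed.

(** * Distances to the nearest node *)

Section Dvec.
Variables (R : realType) (K : fieldType) (abs : K -> R).
Hypothesis Habs : is_absval abs.
Variables (n : nat) (x : 'I_n -> K).
Hypothesis n2 : (2 <= n)%N.

(** For n >= 2 the minimum runs over a nonempty index set, so its default value +oo does not
    survive. *)
Lemma dvec_attained i : exists2 j : 'I_n, j != i & dvec abs x i = abs (x i - x j).
Proof.
rewrite /dvec.
have [j0 j0i] : exists j0 : 'I_n, j0 != i.
  have : (0 < #|[pred j : 'I_n | j != i]|)%N by rewrite card_ord_neq; case: n n2 => [|[]].
  by case/card_gt0P => j; exists j.
have [|j ji ->] := @eq_bigmin _ _ _ (+oo%E : \bar R) j0 (fun j => j != i)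
  (fun j => (abs (x i - x j))%:E) j0i; first by move=> j _; exact: leey.
by exists j.
Qed.

Lemma dvec_le i j : i != j -> dvec abs x i <= abs (x i - x j).
Proof.
move=> ij; have [k ki dk] := dvec_attained i; rewrite dk -lee_fin.
have fk : (\big[Order.min/+oo%E]_(j < n | j != i) (abs (x i - x j))%:E)
  = (abs (x i - x k))%:E.
  rewrite -dk /dvec fineK// fin_numE; apply/andP; split; apply/eqP => h.
    have [|l li] := @eq_bigmin _ _ _ (+oo%E : \bar R) k (fun j => j != i)
      (fun j => (abs (x i - x j))%:E) ki; first by move=> l _; exact: leey.
    by rewrite h.
  have := @bigmin_le_cond _ _ _ (+oo%E : \bar R) k (fun j => j != i)
      (fun j => (abs (x i - x j))%:E) ki.
  by rewrite h leye_eq.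
by rewrite -fk; apply: bigmin_le_cond; rewrite eq_sym.
Qed.

Hypothesis xinj : forall i j : 'I_n, i != j -> x i != x j.

Lemma dvec_gt0 i : 0 < dvec abs x i.
Proof.
have [j ji ->] := dvec_attained i.
by rewrite absv_gt0// subr_eq0 xinj// eq_sym.
Qed.

End Dvec.

(** * Lagrange interpolation at the nodes *)

Section Lagrange.
Variables (K : fieldType) (n : nat) (f : {poly K}) (x : 'I_n -> K).
Hypothesis Hdeg : size f = n.+1.
Hypothesis xinj : forall i j : 'I_n, i != j -> x i != x j.

(** Both sides agree at the n distinct nodes, and their leading terms cancel, so the difference has
    degree less than n. *)
Lemma Wcorr_interpolation z :
  f.[z] = lead_coef f * (\prod_(j < n) (z - x j)
    + \sum_(k < n) Wcorr f x k * \prod_(j < n | j != k) (z - x j)).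
Proof.
have a0 : lead_coef f != 0 by rewrite lead_coef_eq0 -size_poly_gt0 Hdeg.
pose P := \prod_(j < n) ('X - (x j)%:P).
pose Q := \sum_(k < n) Wcorr f x k *: \prod_(j < n | j != k) ('X - (x j)%:P).
have sP : size P = n.+1 by rewrite /P size_prod_XsubC [index_enum _]unlock -enumT size_enum_ord.
have sQ : (size Q <= n)%N.
  apply: (leq_trans (size_sum _ _ _)); apply/bigmax_leqP => k _.
  apply: (leq_trans (size_scale_leq _ _)).
  rewrite -big_filter size_prod_XsubC.
  rewrite (_ : size _ = n.-1) ?prednK ?(leq_ltn_trans _ (ltn_ord k))//.
  by rewrite -(card_ord_neq k) cardE /enum_mem [index_enum _]unlock.
have Pmon : P \is monic by apply: monic_prod_XsubC.
have : f - lead_coef f *: (P + Q) = 0.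
  apply: (@roots_geq_poly_eq0 _ _ [seq x i | i <- enum 'I_n]).
  - apply/allP => _ /mapP[i _ ->]; rewrite rootE hornerD hornerN hornerZ hornerD.
    have -> : P.[x i] = 0.
      by rewrite horner_prod (bigD1 i)//= hornerXsubC subrr mul0r.
    have -> : Q.[x i] = Wcorr f x i * (\prod_(j < n | j != i) ('X - (x j)%:P)).[x i].
      rewrite horner_sum (bigD1 i)//= hornerZ; apply/eqP.
      rewrite addrC -subr_eq0 addrK; apply/eqP/big1 => k ki.
      rewrite hornerZ horner_prod (bigD1 i)/= 1?eq_sym//.
      by rewrite hornerXsubC subrr mul0r mulr0.
    rewrite add0r horner_prod /Wcorr.
    have -> : \prod_(j < n | j != i) ('X - (x j)%:P).[x i]
        = \prod_(j < n | j != i) (x i - x j).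
      by apply: eq_bigr => j _; rewrite hornerXsubC.
    have p0 : \prod_(j < n | j != i) (x i - x j) != 0.
      by apply/prodf_neq0 => j ji; rewrite subr_eq0 xinj// eq_sym.
    by apply/eqP; field; rewrite a0 p0.
  - rewrite map_inj_uniq ?enum_uniq// => i j; apply: contra_eq; exact: xinj.
  - rewrite size_map size_enum_ord; apply/leq_sizeP => j.
    rewrite leq_eqVlt coefB coefZ coefD => /orP[/eqP <-|nj].
      rewrite [Q`_n]nth_default// addr0.
      have -> : P`_n = 1 by move/monicP: Pmon; rewrite lead_coefE sP.
      by rewrite mulr1 lead_coefE Hdeg subrr.
    rewrite !nth_default ?addr0 ?mulr0 ?subr0// ?sP ?Hdeg//.
    exact: leq_trans sQ (ltnW nj).
move/eqP; rewrite subr_eq0 => /eqP {1}->.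
rewrite hornerZ hornerD horner_prod horner_sum; congr (_ * (_ + _)).
  by apply: eq_bigr => j _; rewrite hornerXsubC.
apply: eq_bigr => k _; rewrite hornerZ horner_prod; congr (_ * _).
by apply: eq_bigr => j _; rewrite hornerXsubC.
Qed.

(** Factoring out the product over j <> i leaves z = x_i admissible. Where 1 + sum_(j <> i) W_j / (z
    - x_j) is nonzero, the last factor vanishes exactly at the fixed points of Phi_i. *)
Lemma Wcorr_residual i z : (forall j, j != i -> z != x j) ->
  f.[z] = lead_coef f * \prod_(j < n | j != i) (z - x j) *
    ((z - x i) * (1 + \sum_(j < n | j != i) Wcorr f x j / (z - x j)) + Wcorr f x i).
Proof.
move=> zx; rewrite Wcorr_interpolation -mulrA; congr (_ * _).
rewrite (bigD1 i)//= [\sum_(k < n) _](bigD1 i)//=.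
set p := \prod_(j < n | j != i) _.
have -> : \sum_(k < n | k != i) Wcorr f x k * \prod_(j < n | j != k) (z - x j)
  = p * (z - x i) * \sum_(j < n | j != i) Wcorr f x j / (z - x j).
  rewrite mulr_sumr; apply: eq_bigr => k ki.
  rewrite (bigD1 i)/= 1?eq_sym// /p [in RHS](bigD1 k)//=.
  have -> : \prod_(j < n | (j != k) && (j != i)) (z - x j)
     = \prod_(j < n | (j != i) && (j != k)) (z - x j).
    by apply: eq_bigl => j; rewrite andbC.
  by field; rewrite subr_eq0 zx.
ring.
Qed.

End Lagrange.

(** * A zero in the disc around one node *)

Section RootDisc.
Variables (R : realType) (K : closedFieldType) (abs : K -> R).
Hypothesis Habs : is_absval abs.
Variables (n : nat) (f : {poly K}) (x : 'I_n -> K).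
Hypothesis n2 : (2 <= n)%N.
Hypothesis Hdeg : size f = n.+1.
Hypothesis xinj : forall i j : 'I_n, i != j -> x i != x j.
Variables (i : 'I_n) (t B h : R).
Let W := Wcorr f x.
Let D := dvec abs x i.
Hypothesis t_ge0 : 0 <= t.
Hypothesis B_ge0 : 0 <= B.
Hypothesis h_ge0 : 0 <= h.
Hypothesis hB_lt1 : h + B < 1.
Hypothesis h_fix : h * (1 - h - B) = t * (1 - h).
Hypothesis W_le : abs (W i) <= t * D.
Hypothesis sumW_le : \sum_(j < n | j != i) abs (W j) / dvec abs x j <= B.

Let S z := 1 + \sum_(j < n | j != i) W j / (z - x j).
Let Phi z := x i - W i / S z.
(** With [B] standing for a t, this is the majorant t / (1 - B / (1 - u)); [h_fix] is the equation
    phi(h) = h with its denominator cleared. *)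
Let phi u := t * (1 - u) / (1 - u - B).

Let D_gt0 : 0 < D. Proof. exact: dvec_gt0. Qed.

Let Di_le j : j != i -> D <= abs (x i - x j).
Proof. by move=> ji; apply: dvec_le => //; rewrite eq_sym. Qed.

Let Dj_le j : j != i -> dvec abs x j <= abs (x i - x j).
Proof. by move=> ji; rewrite (absvB Habs)//; apply: dvec_le. Qed.

Let sub1_gt0 (u : R) : u <= h -> 0 < 1 - u.
Proof. by have := B_ge0; have := hB_lt1; lra. Qed.

Let sub1B_gt0 (u : R) : u <= h -> 0 < 1 - u - B.
Proof. by have := hB_lt1; lra. Qed.

Lemma node_dist_ge z (u : R) j : j != i -> 0 <= u <= h -> abs (z - x i) <= u * D ->
  (1 - u) * abs (x i - x j) <= abs (z - x j).
Proof.
move=> ji /andP[u0 uh] zu.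
have := absv_triangle Habs z (x i) (x j); rewrite (absvB Habs (x i) z) => tri.
have := Di_le ji => dle.
have : u * D <= u * abs (x i - x j) by rewrite ler_wpM2l.
lra.
Qed.

Lemma node_neq z (u : R) j : j != i -> 0 <= u <= h -> abs (z - x i) <= u * D -> z != x j.
Proof.
move=> ji uh zu; rewrite -subr_eq0 -(absv_gt0 Habs).
apply: lt_le_trans (node_dist_ge ji uh zu).
by rewrite mulr_gt0 ?sub1_gt0 ?(andP uh).2// (lt_le_trans D_gt0 (Di_le ji)).
Qed.

Lemma absv_sumW_le z (u : R) : 0 <= u <= h -> abs (z - x i) <= u * D ->
  abs (S z - 1) <= B / (1 - u).
Proof.
move=> uh zu; rewrite /S addrAC subrr add0r.
apply: le_trans (absv_sum Habs _ _) _.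
have u1 : 0 < 1 - u by case/andP: uh => _ /sub1_gt0.
rewrite ler_pdivlMr// mulr_suml; apply: le_trans sumW_le; apply: ler_sum => j ji.
rewrite (absvM Habs (W j)) (absvV Habs) -[leLHS]mulrA.
rewrite ler_wpM2l ?(absv_ge0 Habs)//.
have zj : 0 < abs (z - x j).
  by rewrite (absv_gt0 Habs)// subr_eq0; apply: node_neq uh zu.
have dj : 0 < dvec abs x j by exact: dvec_gt0.
rewrite [leLHS]mulrC ler_pdivrMr// [leRHS]mulrC ler_pdivlMr//.
apply: le_trans (node_dist_ge ji uh zu).
by rewrite ler_pM2l//; exact: Dj_le.
Qed.

Lemma S_ge z (u : R) : 0 <= u <= h -> abs (z - x i) <= u * D ->
  (1 - u - B) / (1 - u) <= abs (S z).
Proof.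
move=> uh zu; have u1 : 0 < 1 - u by case/andP: uh => _ /sub1_gt0.
have := absv_sumW_le uh zu.
have := absv_triangle Habs (S z) 1 0; rewrite !subr0 (absv1 Habs)// (absvB Habs)//.
have -> : (1 - u - B) / (1 - u) = 1 - B / (1 - u) by field; rewrite gt_eqF.
lra.
Qed.

Lemma S_gt0 z u : 0 <= u <= h -> abs (z - x i) <= u * D -> 0 < abs (S z).
Proof.
move=> uh zu; apply: lt_le_trans (S_ge uh zu).
by case/andP: uh => _ uh; rewrite divr_gt0 ?sub1B_gt0 ?sub1_gt0.
Qed.

(** Each factor of (z - x_j)(w - x_j) is at least a multiple of |x_i - x_j|; one copy of this
    distance is bounded below by [D], the other by d_j, which leads back to [sumW_le]. *)
Lemma S_lipschitz z w (u v : R) : 0 <= u <= h -> 0 <= v <= h ->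
  abs (z - x i) <= u * D -> abs (w - x i) <= v * D ->
  abs (S z - S w) <= abs (z - w) * (B / (D * ((1 - u) * (1 - v)))).
Proof.
move=> uh vh zu wv.
have u1 : 0 < 1 - u by case/andP: uh => _ /sub1_gt0.
have v1 : 0 < 1 - v by case/andP: vh => _ /sub1_gt0.
have -> : S z - S w
    = - ((z - w) * \sum_(j < n | j != i) W j / ((z - x j) * (w - x j))).
  rewrite /S opprD addrACA subrr add0r -sumrB mulr_sumr -sumrN.
  apply: eq_bigr => j ji; field.
  by rewrite !subr_eq0 (node_neq ji uh zu) (node_neq ji vh wv).
rewrite (absvN Habs)// (absvM Habs)// ler_wpM2l ?(absv_ge0 Habs)//.
apply: le_trans (absv_sum Habs _ _) _.
rewrite ler_pdivlMr ?mulr_gt0// mulr_suml; apply: le_trans sumW_le.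
apply: ler_sum => j ji.
rewrite (absvM Habs (W j)) (absvV Habs) (absvM Habs (z - x j)) -[leLHS]mulrA.
rewrite ler_wpM2l ?(absv_ge0 Habs)//.
have zj : 0 < abs (z - x j).
  by rewrite (absv_gt0 Habs)// subr_eq0; apply: node_neq uh zu.
have wj : 0 < abs (w - x j).
  by rewrite (absv_gt0 Habs)// subr_eq0; apply: node_neq vh wv.
have dj : 0 < dvec abs x j by exact: dvec_gt0.
rewrite [leLHS]mulrC ler_pdivrMr ?mulr_gt0// [leRHS]mulrC ler_pdivlMr//.
have hz := node_dist_ge ji uh zu; have hw := node_dist_ge ji vh wv.
have h1 : D * dvec abs x j <= abs (x i - x j) * abs (x i - x j).
  by apply: ler_pM; [exact: ltW|exact: ltW|exact: Di_le|exact: Dj_le].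
have h2 : ((1 - u) * abs (x i - x j)) * ((1 - v) * abs (x i - x j))
          <= abs (z - x j) * abs (w - x j).
  by apply: ler_pM => //; rewrite mulr_ge0 ?(absv_ge0 Habs)// ltW.
have := ler_wpM2l (ltW (mulr_gt0 u1 v1)) h1.
nra.
Qed.

Lemma phi_sub (u v : R) : u <= h -> v <= h ->
  phi v - phi u = t * B * (v - u) / ((1 - u - B) * (1 - v - B)).
Proof. by move=> uh vh; rewrite /phi; field; rewrite !gt_eqF ?sub1B_gt0. Qed.

Lemma phi_h : phi h = h.
Proof. by rewrite /phi -h_fix mulfK// gt_eqF ?sub1B_gt0. Qed.

Lemma phi_le (u v : R) : u <= v -> v <= h -> phi u <= phi v.
Proof.
move=> uv vh; have uh := le_trans uv vh; rewrite -subr_ge0 phi_sub// divr_ge0//.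
  by rewrite !mulr_ge0// subr_ge0.
by apply: ltW; rewrite mulr_gt0// sub1B_gt0.
Qed.

(* The real map [phi] majorizes [Phi] exactly, so the estimate survives at the
   boundary value of [t], where [phi] is not a strict contraction. *)
Lemma Phi_step z (u : R) : 0 <= u -> u <= phi u -> phi u <= h ->
  abs (z - x i) <= u * D -> abs (Phi z - z) <= (phi u - u) * D ->
  [/\ phi u <= phi (phi u), phi (phi u) <= h, abs (Phi z - x i) <= phi u * D
    & abs (Phi (Phi z) - Phi z) <= (phi (phi u) - phi u) * D].
Proof.
move=> u0 uv vh zu step; set v := phi u in uv vh step *; set w := Phi z.
have wv : abs (w - x i) <= v * D.
  have := absv_triangle Habs z w (x i); rewrite /w; lra.
split => //; [exact: phi_le|by rewrite -phi_h; exact: phi_le|].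
have uh : 0 <= u <= h by apply/andP; split; lra.
have vh' : 0 <= v <= h by apply/andP; split; lra.
have Sz := S_gt0 uh zu; have Sw := S_gt0 vh' wv.
have Szn : S z != 0 by rewrite -(absv_gt0 Habs).
have Swn : S w != 0 by rewrite -(absv_gt0 Habs).
have -> : Phi w - w = W i * (S w - S z) / (S z * S w).
  by rewrite {1}/Phi {2}/w /Phi; field; rewrite Szn Swn.
rewrite (absvM Habs (_ * _)) (absvV Habs) (absvM Habs (W i)) (absvM Habs (S z)).
have lip := S_lipschitz vh' uh wv zu.
have [u1 v1] : 0 < 1 - u /\ 0 < 1 - v by split; apply: sub1_gt0; lra.
have [u2 v2] : 0 < 1 - u - B /\ 0 < 1 - v - B by split; apply: sub1B_gt0; lra.
have num : abs (W i) * abs (S w - S z) <=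
    (t * D) * (((v - u) * D) * (B / (D * ((1 - v) * (1 - u))))).
  apply: ler_pM; rewrite ?(absv_ge0 Habs)//; apply: le_trans lip _.
  by rewrite ler_wpM2r// divr_ge0// !mulr_ge0// ltW.
have den : ((1 - u - B) / (1 - u)) * ((1 - v - B) / (1 - v)) <= abs (S z) * abs (S w).
  by apply: ler_pM (S_ge uh zu) (S_ge vh' wv); rewrite divr_ge0 ?ltW.
rewrite ler_pdivrMr ?mulr_gt0//; apply: (le_trans num).
(* The bounds on numerator and denominator combine to exactly phi v - phi u = phi v - v, in units of
   [D]. *)
have -> : t * D * ((v - u) * D * (B / (D * ((1 - v) * (1 - u))))) =
   (phi v - v) * D * ((1 - u - B) / (1 - u) * ((1 - v - B) / (1 - v))).
  have -> : phi v - v = t * B * (v - u) / ((1 - u - B) * (1 - v - B)).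
    by apply: phi_sub => //; lra.
  by field; rewrite !gt_eqF.
rewrite ler_wpM2l// mulr_ge0 ?(ltW D_gt0)// subr_ge0; exact: phi_le.
Qed.

(** The residual formula reads f(z) = - a_0 prod_(j <> i) (z - x_j) S(z) (Phi(z) - z). Here |S| <= 2
    because B <= 1 - h, and |z - x_j| <= 2 |x_i - x_j| because h < 1. *)
Lemma absv_horner_le z : abs (z - x i) <= h * D ->
  abs f.[z] <= abs (lead_coef f) * \prod_(j < n | j != i) (2 * abs (x i - x j)) * 2
    * abs (Phi z - z).
Proof.
move=> zh; have hh : 0 <= h <= h by rewrite h_ge0 lexx.
have Sn : S z != 0 by rewrite -(absv_gt0 Habs) (S_gt0 hh zh).
rewrite (Wcorr_residual Hdeg xinj (i := i)); last by move=> j ji; exact: node_neq ji hh zh.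
have -> : (z - x i) * (1 + \sum_(j < n | j != i) Wcorr f x j / (z - x j)) + Wcorr f x i
   = - (S z * (Phi z - z)).
  by rewrite /Phi -/W -/(S z); field.
rewrite (absvM Habs) (absvM Habs (lead_coef f)) (absvN Habs) (absvM Habs (S z)) (absv_prod Habs).
have S2 : abs (S z) <= 2.
  have := absv_sumW_le hh zh; have := absv_triangle Habs 1 (S z) 0.
  rewrite !subr0 (absv1 Habs)//.
  suff : B / (1 - h) <= 1 by lra.
  by rewrite ler_pdivrMr ?sub1_gt0//; have := sub1B_gt0 (lexx h); lra.
have prod_le : \prod_(j < n | j != i) abs (z - x j)
    <= \prod_(j < n | j != i) (2 * abs (x i - x j)).
  apply: ler_prod => j ji; rewrite (absv_ge0 Habs)/=.
  have := absv_triangle Habs (x i) z (x j); have := Di_le ji.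
  have : h * D <= 1 * D.
    by rewrite ler_wpM2r ?(ltW D_gt0)// -subr_ge0 ltW ?sub1_gt0.
  lra.
rewrite -[leRHS]mulrA ler_pM ?mulr_ge0 ?prodr_ge0 ?(absv_ge0 Habs)//.
- by move=> j _; exact: absv_ge0.
- by rewrite ler_wpM2l ?(absv_ge0 Habs).
- by rewrite ler_wpM2r ?(absv_ge0 Habs).
Qed.

(** Without a zero in the disc, |f| >= c > 0 there, so every step of [Phi] has length at least d D.
    But the steps from x_i are majorized by the increments of the real orbit of 0 under [phi], which
    stays below [h]; after k > h / d steps this is absurd. *)
Lemma root_disc : exists2 xi, root f xi & abs (xi - x i) <= h * D.
Proof.
have a0 : lead_coef f != 0 by rewrite lead_coef_eq0 -size_poly_gt0 Hdeg.
have [rs frs] := closed_field_poly_normal f.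
have [/hasP[r rrs rh]|/hasPn far] := boolP (has (fun r => abs (r - x i) <= h * D) rs).
  by exists r => //; rewrite frs rootZ// root_prod_XsubC.
exfalso.
pose c := abs (lead_coef f) * \prod_(r <- rs) (abs (r - x i) - h * D).
pose C := abs (lead_coef f) * \prod_(j < n | j != i) (2 * abs (x i - x j)) * 2.
have c0 : 0 < c.
  rewrite mulr_gt0 ?(absv_gt0 Habs)// big_seq prodr_gt0// => r /far.
  by rewrite -ltNge subr_gt0.
have C0 : 0 < C.
  rewrite !mulr_gt0 ?(absv_gt0 Habs)// prodr_gt0// => j ji.
  by rewrite mulr_gt0// (absv_gt0 Habs)// subr_eq0 xinj// eq_sym.
have fc z : abs (z - x i) <= h * D -> c <= abs f.[z].
  move=> zh; rewrite frs hornerZ horner_prod (absvM Habs)// /c.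
  rewrite ler_wpM2l ?(absv_ge0 Habs)// (big_morph _ (absvM Habs) (absv1 Habs)).
  rewrite [leRHS]big_seq big_seq.
  apply: ler_prod => r /far; rewrite -ltNge => rh; rewrite hornerXsubC subr_ge0 ltW//=.
  by have := absv_triangle Habs z r (x i); rewrite (absvB Habs r z); lra.
pose d := c / C / D.
have d0 : 0 < d by rewrite !divr_gt0.
have stepd z : abs (z - x i) <= h * D -> d * D <= abs (Phi z - z).
  move=> zh; rewrite /d divfK ?gt_eqF// ler_pdivrMr// mulrC.
  exact: le_trans (fc z zh) (absv_horner_le zh).
have [k kh] : exists k : nat, h < k%:R * d.
  exists (Num.Def.archi_bound (h / d)); rewrite -ltr_pdivrMr//.
  by apply: archi_boundP; rewrite divr_ge0// ltW.
suff [z [u [u0 uv vh zu [step kd]]]] : exists z (u : R), [/\ 0 <= u, u <= phi u, phi u <= h,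
    abs (z - x i) <= u * D & abs (Phi z - z) <= (phi u - u) * D /\ k%:R * d <= u].
  by have := lt_le_trans kh (le_trans kd (le_trans uv vh)); rewrite ltxx.
elim: k {kh} => [|k [z [u [u0 uv vh zu [step kd]]]]].
  exists (x i), (0 : R); have h00 : 0 <= (0:R) <= h by rewrite lexx h_ge0.
  have z0 : abs (x i - x i) <= 0 * D by rewrite subrr (absv0 Habs)// mul0r.
  have p0 : 0 <= phi 0 by rewrite /phi divr_ge0 ?mulr_ge0// ltW ?sub1_gt0 ?sub1B_gt0.
  split=> //; first by rewrite -[leRHS]phi_h; exact: phi_le.
  split; last by rewrite mul0r.
  rewrite subr0 /Phi addrAC subrr add0r (absvN Habs) (absvM Habs (W i)) (absvV Habs).
  rewrite ler_pdivrMr ?(S_gt0 h00 z0)//.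
  apply: (le_trans W_le); rewrite -mulrA.
  have := S_ge h00 z0; rewrite subr0 divr1 => Sge.
  have -> : t * D = phi 0 * (D * (1 - B)).
    by rewrite /phi subr0 mulr1; field; have := sub1B_gt0 h_ge0; rewrite subr0 => /gt_eqF ->.
  by rewrite ler_wpM2l// ler_wpM2l// ltW.
have [w1 w2 w3 w4] := Phi_step u0 uv vh zu step.
exists (Phi z), (phi u); split=> //; first by lra.
split=> //; rewrite -addn1 natrD mulrDl mul1r.
suff : d <= phi u - u by lra.
rewrite -(ler_pM2r D_gt0); apply: le_trans step; apply: stepd.
by apply: (le_trans zu); rewrite ler_wpM2r ?(ltW D_gt0)//; lra.
Qed.

(** At a zero in the disc the residual bracket vanishes, so |xi - x_i| |S(xi)| = |W_i|, and [S_ge]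
    bounds |S(xi)| from below. *)
Lemma root_disc_le xi : root f xi -> abs (xi - x i) <= h * D ->
  abs (xi - x i) * ((1 - h - B) / (1 - h)) <= abs (W i).
Proof.
move=> rxi xh; have hh : 0 <= h <= h by rewrite h_ge0 lexx.
have a0 : lead_coef f != 0 by rewrite lead_coef_eq0 -size_poly_gt0 Hdeg.
have nn j : j != i -> xi != x j by move=> ji; exact: node_neq ji hh xh.
have : (xi - x i) * S xi + W i = 0.
  move: rxi; rewrite rootE (Wcorr_residual Hdeg xinj (i := i))// mulf_eq0.
  rewrite mulf_eq0 (negbTE a0)/= => /orP[/prodf_eq0[j ji]|/eqP//].
  by rewrite subr_eq0 (negbTE (nn j ji)).
move/eqP; rewrite addrC addr_eq0 => /eqP ->; rewrite (absvN Habs)// (absvM Habs)//.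
by rewrite ler_wpM2l ?(absv_ge0 Habs)//; exact: S_ge.
Qed.

End RootDisc.

(** * Local convergence near a root-vector *)

Lemma expr1D_sub1_le (R : realType) (y : R) m : 0 <= y <= 1 ->
  (1 + y) ^+ m - 1 <= 2 ^+ m * y.
Proof.
case/andP=> y0 y1; elim: m => [|m IH]; first by rewrite !expr0 subrr mul1r.
have p2 : (1 + y) ^+ m <= 2 ^+ m by rewrite lerXn2r ?nnegrE//; lra.
rewrite !exprS; have : (1 + y) ^+ m * y <= 2 ^+ m * y by rewrite ler_wpM2r.
lra.
Qed.

Lemma maxnorm_ge (R : realType) (K : fieldType) (abs : K -> R) n (v : 'I_n -> K) i :
  abs (v i) <= maxnorm abs v.
Proof. exact: (@le_bigmax _ _ _ 0 (fun i => abs (v i)) i). Qed.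

Section LocalConvergence.
Variables (R : realType) (K : fieldType) (abs : K -> R).
Hypothesis Habs : is_absval abs.
Variables (n : nat) (f : {poly K}) (xi : 'I_n -> K).
Hypothesis f_neq0 : f != 0.
Hypothesis xi_root : root_vector f xi.
Variables (w : 'I_n -> R) (h tau : R).
Hypothesis w_bnd : forall j, 0 <= w j <= h.
Hypothesis prod_w_le : forall i, \prod_(j < n | j != i) (1 + w j) <= tau.
Hypothesis tau_ge1 : 1 <= tau.
Hypothesis h_ge0 : 0 <= h.
Hypothesis tau_lt : (1 + 2 * h) * tau < 2.

(* Fixed weights [w j] dominate the ratios [|x_j - xi_j| / d_j(x)] along the whole
   orbit; they replace the p-norm of these ratios as the invariant. *)
Definition close (x : 'I_n -> K) := forall i j, i != j ->
  x i != x j /\ abs (x j - xi j) <= w j * abs (x i - x j).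

Let htau : 0 <= h * tau /\ 2 * (h * tau) < 2 - tau.
Proof. by split; [apply: mulr_ge0 => //; apply: le_trans tau_ge1|move: tau_lt; nra]. Qed.

Let h_lt : 2 * h < 1.
Proof. by move: tau_lt h_ge0 tau_ge1; nra. Qed.

Let close_dist_gt0 x i j : close x -> i != j -> 0 < abs (x i - x j).
Proof. by move=> cx ij; rewrite (absv_gt0 Habs) subr_eq0; case: (cx i j ij). Qed.

Let close_le x i j : close x -> i != j -> abs (x j - xi j) <= h * abs (x i - x j).
Proof.
move=> cx ij; apply: le_trans (cx i j ij).2 _.
by rewrite ler_wpM2r ?(absv_ge0 Habs)//; case/andP: (w_bnd j).
Qed.

Lemma Tmap_error x M i : (forall j, j != i -> x i != Tmap f M x j) ->
  Tmap f M.+1 x i - xi i = (x i - xi i) *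
   - (\prod_(j < n | j != i)
         (1 + (Tmap f M x j - xi j) / (x i - Tmap f M x j)) - 1).
Proof.
move=> xT /=; rewrite xi_root (bigD1 i)//=.
have a0 : lead_coef f != 0 by rewrite lead_coef_eq0.
have -> : \prod_(j < n | j != i)
      (1 + (Tmap f M x j - xi j) / (x i - Tmap f M x j)) =
   \prod_(j < n | j != i) (x i - xi j) / \prod_(j < n | j != i) (x i - Tmap f M x j).
  rewrite -prodf_div; apply: eq_bigr => j ji; field.
  by rewrite subr_eq0 xT.
have p0 : \prod_(j < n | j != i) (x i - Tmap f M x j) != 0.
  by apply/prodf_neq0 => j ji; rewrite subr_eq0 xT.
by field; rewrite p0 a0.
Qed.

(** Invariant for the induction on the stage: [close] with x_j, but not x_i, replaced by its image
    at stage [M]. *)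
Let separated M x := forall i j, i != j -> x i != Tmap f M x j /\
  abs (Tmap f M x j - xi j) <= w j * abs (x i - Tmap f M x j).

Let separated_contract M x i : separated M x ->
  abs (Tmap f M.+1 x i - xi i) <= (tau - 1) * abs (x i - xi i).
Proof.
move=> sep; rewrite Tmap_error; last first.
  by move=> j ji; case: (sep i j) => //; rewrite eq_sym.
rewrite (absvM Habs) (absvN Habs) mulrC ler_wpM2r ?(absv_ge0 Habs)//.
apply: le_trans (absv_prod1D_sub1 Habs _ _) _; rewrite lerB//.
apply: le_trans (prod_w_le i); apply: ler_prod => j ji.
rewrite addr_ge0 ?(absv_ge0 Habs)//= lerD2l (absvM Habs) (absvV Habs).
have [|xT le] := sep i j; first by rewrite eq_sym.
by rewrite ler_pdivrMr// (absv_gt0 Habs) subr_eq0.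
Qed.

Let moved_dist x i j y : close x -> i != j ->
  abs (y - xi j) <= (tau - 1) * abs (x j - xi j) ->
  abs (x i - x j) - tau * abs (x j - xi j) <= abs (x i - y).
Proof.
move=> cx ij yj.
have := absv_triangle Habs y (x i) (x j); have := absv_triangle Habs (xi j) y (x j).
rewrite (absvB Habs (xi j)); lra.
Qed.

(** With e = |x_j - xi_j| and d = |x_i - x_j|, the image of x_j lies within tau e of x_j, hence at
    distance at least d - tau e from x_i. Then w_j (d - tau e) >= (1 - h tau) e >= (tau - 1) e. *)
Lemma close_separated M x : close x -> separated M x.
Proof.
move=> cx; elim: M => [|M IH] i j ij; first exact: cx.
have con := separated_contract j IH.
have lb := moved_dist cx ij con.
have d0 := close_dist_gt0 cx ij; have eh := close_le cx ij.
have e0 := absv_ge0 Habs (x j - xi j).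
have [_ ew] := cx i j ij; have /andP[w0 wh] := w_bnd j.
have [ht0 ht] := htau; have tau1 := tau_ge1.
set d := abs (x i - x j) in lb d0 eh ew *; set e := abs (x j - xi j) in con lb eh e0 ew *.
set y := Tmap f M.+1 x j in con lb *.
have te : tau * e <= h * tau * d by rewrite [h * _]mulrC -mulrA ler_wpM2l//; lra.
have hd : h * tau * d <= 1 / 2 * d by rewrite ler_wpM2r ?ltW//; lra.
split; first by rewrite -subr_eq0 -(absv_gt0 Habs); lra.
apply: (le_trans con).
apply: le_trans (ler_wpM2l w0 lb).
have : w j * (tau * e) <= h * (tau * e) by rewrite ler_wpM2r// mulr_ge0//; lra.
have : 0 <= (2 - tau - 2 * (h * tau)) * e by rewrite mulr_ge0//; lra.
have : 0 <= h * tau * e by rewrite mulr_ge0.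
nra.
Qed.

Lemma close_contract M x i : close x ->
  abs (Tmap f M.+1 x i - xi i) <= (tau - 1) * abs (x i - xi i).
Proof. by move=> cx; apply: separated_contract; exact: close_separated. Qed.

Lemma close_Dom M x : close x -> Dom f M x.
Proof.
move=> cx; elim: M => //= M IH; split=> // i j ij.
by case: (close_separated M cx ij).
Qed.

(** Now both points move, so their distance keeps at least the fraction 1 - 2 h tau. The errors
    shrink by tau - 1, and tau - 1 < 1 - 2 h tau is exactly (1 + 2 h) tau < 2. *)
Lemma close_Tmap M x : close x -> close (Tmap f M.+1 x).
Proof.
move=> cx i j ij.
have coni := close_contract M i cx; have conj := close_contract M j cx.
have d0 := close_dist_gt0 cx ij; have ehj := close_le cx ij.
have := close_le cx (i := j) (j := i); rewrite eq_sym => /(_ ij).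
rewrite (absvB Habs (x j)) => ehi.
have e0i := absv_ge0 Habs (x i - xi i); have e0j := absv_ge0 Habs (x j - xi j).
have [_ ew] := cx i j ij; have /andP[w0 wh] := w_bnd j.
have [ht0 ht] := htau; have tau1 := tau_ge1.
have lb : abs (x i - x j) - tau * abs (x i - xi i) - tau * abs (x j - xi j)
  <= abs (Tmap f M.+1 x i - Tmap f M.+1 x j).
  have := moved_dist cx ij conj.
  have := absv_triangle Habs (Tmap f M.+1 x i) (x i) (Tmap f M.+1 x j).
  have := absv_triangle Habs (xi i) (x i) (Tmap f M.+1 x i).
  rewrite (absvB Habs (xi i)); lra.
set d := abs (x i - x j) in lb d0 ehi ehj ew *.
set ei := abs (x i - xi i) in coni lb ehi e0i *.
set ej := abs (x j - xi j) in conj lb ehj e0j ew *.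
have lb' : (1 - 2 * (h * tau)) * d <= abs (Tmap f M.+1 x i - Tmap f M.+1 x j).
  have : tau * ei <= tau * (h * d) by rewrite ler_wpM2l//; lra.
  have : tau * ej <= tau * (h * d) by rewrite ler_wpM2l//; lra.
  lra.
have pos : 0 < (1 - 2 * (h * tau)) * d by rewrite mulr_gt0//; lra.
split; first by rewrite -subr_eq0 -(absv_gt0 Habs); lra.
apply: (le_trans conj); apply: le_trans (ler_wpM2l w0 lb').
have : 0 <= (2 - tau - 2 * (h * tau)) * ej by rewrite mulr_ge0//; lra.
have : (1 - 2 * (h * tau)) * ej <= (1 - 2 * (h * tau)) * (w j * d).
  by rewrite ler_wpM2l//; lra.
lra.
Qed.

Lemma close_iter M x k : close x -> close (iterW f M.+1 x k).
Proof. by move=> cx; elim: k => //= k; exact: close_Tmap. Qed.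

Lemma close_iter_le M x k i : close x ->
  abs (iterW f M.+1 x k i - xi i) <= (tau - 1) ^+ k * abs (x i - xi i).
Proof.
move=> cx; elim: k => [|k IH]; first by rewrite expr0 mul1r.
rewrite exprS -mulrA; apply: le_trans (close_contract M i (close_iter M k cx)) _.
by rewrite ler_wpM2l// subr_ge0.
Qed.

(** All three follow from h < 1/2. The first transfers the separation of the zeros to the iterates;
    the others decide which zero belongs to which component. *)
Lemma close_roots_dist x i j : close x -> i != j ->
  [/\ abs (xi i - xi j) <= 2 * abs (x i - x j),
      2 * abs (x i - xi i) < abs (x i - x j) & 2 * abs (x j - xi j) < abs (x i - x j)].
Proof.
move=> cx ij.
have d0 := close_dist_gt0 cx ij; have ehj := close_le cx ij.
have := close_le cx (i := j) (j := i); rewrite eq_sym => /(_ ij).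
rewrite (absvB Habs (x j)) => ehi.
have hd : 2 * (h * abs (x i - x j)) < abs (x i - x j).
  by rewrite mulrA -[ltRHS]mul1r ltr_pM2r.
have := absv_triangle Habs (x i) (xi i) (xi j).
have := absv_triangle Habs (x j) (x i) (xi j).
have := absv_triangle Habs (xi i) (x i) (x j).
have := absv_triangle Habs (xi j) (xi i) (x j).
rewrite (absvB Habs (xi i) (x i)) (absvB Habs (xi j) (x j)) => *.
by split; lra.
Qed.

(** In [Tmap_error] the factor after x_i - xi_i is of the order of the error at the previous stage,
    so each stage raises the exponent by one. *)
Lemma Tmap_order D M : 0 < D -> exists2 C, 0 <= C &
  forall x, close x -> (forall i j, i != j -> D <= abs (x i - x j)) ->
  forall i, abs (Tmap f M x i - xi i) <=
    C * maxnorm abs (fun i => x i - xi i) ^+ M.+1.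
Proof.
move=> D0; elim: M => [|M [C C0 IH]].
  by exists 1 => // x _ _ i; rewrite expr1 mul1r; exact: (maxnorm_ge _ (fun i => x i - xi i)).
exists (2 ^+ n.-1 * (C / (D / 2))); first by rewrite mulr_ge0 ?divr_ge0 ?(ltW D0).
move=> x cx dx i; set e := maxnorm _ _.
have ei : abs (x i - xi i) <= e := maxnorm_ge abs (fun i => x i - xi i) i.
have e0 : 0 <= e by apply: le_trans ei; exact: absv_ge0.
have sep := close_separated M cx.
have TD j : j != i -> D / 2 <= abs (x i - Tmap f M x j).
  rewrite eq_sym => ij; have := dx i j ij.
  case: M {IH sep} => [|M] /=; first by lra.
  have := moved_dist cx ij (close_contract M j cx).
  have [ht0 ht] := htau; have tau1 := tau_ge1.
  have : tau * abs (x j - xi j) <= tau * (h * abs (x i - x j)).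
    by rewrite ler_wpM2l ?close_le//; lra.
  have := close_dist_gt0 cx ij; set d := abs (x i - x j) => d0 dd.
  have : h * tau * d <= 1 / 2 * d by rewrite ler_wpM2r ?(ltW d0)//; lra.
  lra.
rewrite Tmap_error; last by move=> j ji; case: (sep i j) => //; rewrite eq_sym.
rewrite (absvM Habs) (absvN Habs) exprS mulrCA ler_pM ?(absv_ge0 Habs)//.
apply: le_trans (absv_prod1D_sub1 Habs _ _) _.
set r := C * e ^+ M.+1 / (D / 2).
have r0 : 0 <= r by rewrite divr_ge0 ?mulr_ge0 ?exprn_ge0 ?(ltW D0).
(* [expr1D_sub1_le] needs a bound at most 1; truncating is legitimate because w_j <= h < 1/2 already
   keeps the quotients below 1. *)
pose y := Num.min r 1.
have y01 : 0 <= y <= 1 by rewrite le_min r0 ler01 ge_min lexx orbT.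
have uy j : j != i -> abs ((Tmap f M x j - xi j) / (x i - Tmap f M x j)) <= y.
  move=> ji; have ij : i != j by rewrite eq_sym.
  have d0 : 0 < abs (x i - Tmap f M x j).
    by apply: lt_le_trans (TD j ji); rewrite divr_gt0.
  have [_ tw] := sep i j ij; rewrite (absvM Habs) (absvV Habs) le_min.
  rewrite !ler_pdivrMr// mul1r; apply/andP; split.
    apply: le_trans (IH x cx dx j) _; rewrite -/e /r -[leRHS]mulrA.
    rewrite ler_peMr ?mulr_ge0 ?exprn_ge0// mulrC ler_pdivlMr ?mul1r ?TD//.
    by rewrite divr_gt0.
  apply: (le_trans tw); rewrite ler_piMl ?(ltW d0)//.
  by case/andP: (w_bnd j) => _ wh; have := h_lt; have := h_ge0; lra.
have : \prod_(j < n | j != i) (1 + abs ((Tmap f M x j - xi j) / (x i - Tmap f M x j)))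
     <= (1 + y) ^+ n.-1.
  rewrite -(card_ord_neq i) -prodr_const; apply: ler_prod => j ji.
  by rewrite addr_ge0 ?(absv_ge0 Habs)//= lerD2l uy.
have := expr1D_sub1_le n.-1 y01.
have : 2 ^+ n.-1 * y <= 2 ^+ n.-1 * r by rewrite ler_wpM2l// ge_min lexx.
have -> : 2 ^+ n.-1 * r = 2 ^+ n.-1 * (C / (D / 2)) * e ^+ M.+1 by rewrite /r; ring.
lra.
Qed.

End LocalConvergence.

(** * Simple zeros and geometric decay *)

Lemma distinct_roots_factor (K : fieldType) (n : nat) (f : {poly K}) (xi : 'I_n -> K) :
  size f = n.+1 -> injective xi -> (forall i, root f (xi i)) ->
  f = lead_coef f *: \prod_(i < n) ('X - (xi i)%:P).
Proof.
move=> Hdeg xi_inj rxi.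
rewrite [LHS](@all_roots_prod_XsubC _ f [seq xi i | i <- enum 'I_n]).
- by rewrite big_map big_enum.
- by rewrite size_map size_enum_ord.
- by apply/allP => _ /mapP[i _ ->].
- by rewrite uniq_rootsE map_inj_uniq ?enum_uniq.
Qed.

Lemma distinct_roots_simple (K : fieldType) (n : nat) (f : {poly K}) (xi : 'I_n -> K) z :
  size f = n.+1 -> injective xi -> (forall i, root f (xi i)) -> root f z ->
  ~~ (('X - z%:P) ^+ 2 %| f).
Proof.
move=> Hdeg xi_inj rxi rz.
have a0 : lead_coef f != 0 by rewrite lead_coef_eq0 -size_poly_gt0 Hdeg.
have fE := distinct_roots_factor Hdeg xi_inj rxi.
move: rz; rewrite fE rootZ// rootE horner_prod => /prodf_eq0[i _].
rewrite hornerXsubC subr_eq0 => /eqP ->.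
rewrite dvdpZr// (bigD1 i)//= expr2 dvdp_mul2l ?polyXsubC_eq0// dvdp_XsubCl.
rewrite rootE horner_prod; apply/prodf_neq0 => j ji.
by rewrite hornerXsubC subr_eq0; apply: contraNneq ji => /xi_inj ->.
Qed.

Lemma geometric_lt (R : realType) (q E eps : R) : 0 <= q < 1 -> 0 <= E -> 0 < eps ->
  exists k0 : nat, forall k, (k0 <= k)%N -> q ^+ k * E < eps.
Proof.
case/andP=> q0 q1 E0 eps0.
(* Bernoulli's inequality, as q^k <= 1 / (1 + k (1 - q)). *)
have bern k : (1 + k%:R * (1 - q)) * q ^+ k <= 1.
  elim: k => [|k IH]; first by rewrite mul0r addr0 expr0 mulr1.
  apply: le_trans IH; rewrite exprSr mulrA -subr_ge0.
  have -> : (1 + k%:R * (1 - q)) * q ^+ k - (1 + k.+1%:R * (1 - q)) * q ^+ k * q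
      = k.+1%:R * (1 - q) ^+ 2 * q ^+ k by rewrite -natr1; ring.
  by rewrite !mulr_ge0 ?exprn_ge0 ?subr_ge0 ?(ltW q1).
have s0 : 0 < eps * (1 - q) by rewrite mulr_gt0// subr_gt0.
exists (Num.Def.archi_bound (E / (eps * (1 - q)))) => k k0k.
have Ek : E <= k%:R * (eps * (1 - q)).
  rewrite -ler_pdivrMr//; apply: le_trans (ltW (archi_boundP _)) _.
    by rewrite divr_ge0// ltW.
  by rewrite ler_nat.
have c0 : 0 < 1 + k%:R * (1 - q) by rewrite ltr_pwDl ?mulr_ge0// subr_ge0 ltW.
rewrite -(ltr_pM2l c0) mulrA.
apply: (@le_lt_trans _ _ E); first by rewrite ler_piMl.
lra.
Qed.

(** * The root-vector obtained from the initial conditions *)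

Section Semilocal.
Variables (R : realType) (K : closedFieldType) (abs : K -> R).
Hypothesis Habs : is_absval abs.
Variables (n : nat) (f : {poly K}) (p : \bar R) (x : 'I_n -> K).
Hypothesis n2 : (2 <= n)%N.
Hypothesis Hdeg : size f = n.+1.
Hypothesis Hp : (1 <= p)%E.
Hypothesis xinj : forall i j : 'I_n, i != j -> x i != x j.
Let a : R := n.-1%:R `^ (1 - invp p).
Let t := Ef abs p f x.
Hypothesis t_le : t <= 1 / (1 + Num.sqrt a) ^+ 2.
Hypothesis Omega_lt : Omega n p a t < 2.
Let al := alphaf a t.
Let h := hf a t.
Let W := Wcorr f x.
Let v j := abs (W j) / dvec abs x j.

Let n1 : (1 : R) <= n.-1%:R.
Proof. by rewrite (ler_nat R 1) -subn1 subn_gt0. Qed.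

Let invp01 : 0 <= invp p <= 1.
Proof.
case: p Hp => [r| |]//= r1; last by rewrite lexx ler01.
by rewrite invr_ge0 invf_le1 ?(le_trans ler01)//= (lt_le_trans ltr01).
Qed.

Let a_ge1 : 1 <= a.
Proof.
rewrite -[leLHS](powRr0 (n.-1%:R : R)); apply: ler_powR => //.
by case/andP: invp01; rewrite subr_ge0.
Qed.

Let v_ge0 j : 0 <= v j.
Proof. by rewrite divr_ge0 ?(absv_ge0 Habs)// ltW// dvec_gt0. Qed.

Let t_ge0 : 0 <= t.
Proof.
have i0 : 'I_n := Ordinal (ltnW n2).
exact: le_trans (v_ge0 i0) (ler_pnorm i0 Hp v_ge0).
Qed.

Let al_gt0 : 0 < al. Proof. by have [] := alphaf_root a_ge1 t_ge0 t_le. Qed.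

Let al_quad : t * al ^+ 2 - (1 - (a - 1) * t) * al + 1 = 0.
Proof. by have [] := alphaf_root a_ge1 t_ge0 t_le. Qed.

Let h_ge0 : 0 <= h. Proof. by rewrite mulr_ge0// ltW. Qed.

(** The second factor of [Psi] at h, so that Omega(t) is 1 + 2 h times it; it serves as tau. *)
Definition weierstrass_factor : R := (1 + h / n.-1%:R `^ invp p) ^+ n.-1.

Lemma weierstrass_factor_ge1 : 1 <= weierstrass_factor.
Proof. by rewrite exprn_ege1// lerDl divr_ge0 ?powR_ge0. Qed.

Lemma weierstrass_factor_lt : (1 + 2 * h) * weierstrass_factor < 2.
Proof. exact: Omega_lt. Qed.

Let h_lt : 2 * h < 1.
Proof.
have := weierstrass_factor_lt; have := weierstrass_factor_ge1.
by have := h_ge0; nra.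
Qed.

(** The quadratic equation for alpha with h = t alpha substituted; multiplied by t it becomes the
    fixed point equation for h. *)
Let al_fix : al * (1 - h - a * t) = 1 - h.
Proof. by move: al_quad; rewrite /h /hf -/al; lra. Qed.

Let ht_lt1 : 0 < 1 - h - a * t.
Proof. by rewrite -(pmulr_rgt0 _ al_gt0) al_fix; have := h_lt; have := h_ge0; lra. Qed.

Definition weierstrass_weight j : R := al * v j.

Lemma weierstrass_weight_bnd j : 0 <= weierstrass_weight j <= h.
Proof.
rewrite /weierstrass_weight mulr_ge0 ?(ltW al_gt0)//= /h /hf -/al mulrC.
by rewrite ler_wpM2r ?(ltW al_gt0)//; exact: ler_pnorm.
Qed.

(** Hölder bounds the sum of the weights by alpha a t = a h, and a / (n - 1) = (n - 1)^(-1/p) turns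
    this into the mean required by the arithmetic-geometric inequality. *)
Lemma prod_weierstrass_weight_le i :
  \prod_(j < n | j != i) (1 + weierstrass_weight j) <= weierstrass_factor.
Proof.
apply: prod1D_le_mean => [j|]; first by case/andP: (weierstrass_weight_bnd j).
rewrite -mulr_sumr.
have -> : n.-1%:R * (h / n.-1%:R `^ invp p) = al * (a * t).
  have -> : a = n.-1%:R / n.-1%:R `^ invp p.
    rewrite /a powRB ?powRr1//; apply/implyP => _.
    by rewrite gt_eqF// (lt_le_trans ltr01).
  by rewrite /h /hf -/al; ring.
by rewrite ler_pM2l//; exact: sum_le_pnorm.
Qed.

Lemma weierstrass_root_vector : exists xi : 'I_n -> K,
  [/\ root_vector f xi, injective xi, forall i, root f (xi i),
      forall i, abs (x i - xi i) <= al * abs (W i)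
    & close abs xi weierstrass_weight x].
Proof.
have t0 := t_ge0; have B0 : 0 <= a * t by rewrite mulr_ge0// (le_trans ler01 a_ge1).
have hB : h + a * t < 1 by have := ht_lt1; lra.
have hfix : h * (1 - h - a * t) = t * (1 - h) by rewrite -[in RHS]al_fix mulrA.
have dW i : al * abs (W i) <= h * dvec abs x i.
  rewrite -ler_pdivrMr ?dvec_gt0// -mulrA.
  by case/andP: (weierstrass_weight_bnd i).
have Wt i : abs (W i) <= t * dvec abs x i.
  by rewrite -ler_pdivrMr ?dvec_gt0//; exact: ler_pnorm i Hp v_ge0.
have vB i : \sum_(j < n | j != i) v j <= a * t by exact: sum_le_pnorm.
have disc i : exists z, root f z /\ abs (x i - z) <= al * abs (W i).
  have [z rz zh] := root_disc Habs n2 Hdeg xinj t0 B0 h_ge0 hB hfix (Wt i) (vB i).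
  exists z; split=> //; have := root_disc_le Habs n2 Hdeg xinj B0 h_ge0 hB (vB i) rz zh.
  rewrite (absvB Habs (x i)) -(ler_pM2l al_gt0) mulrCA.
  (* By [al_fix] the factor of [root_disc_le] is 1 / alpha, so h d_i is sharpened to alpha |W_i|. *)
  have -> : al * ((1 - h - a * t) / (1 - h)) = 1.
    by rewrite mulrA al_fix divff// gt_eqF//; have := h_lt; have := h_ge0; lra.
  by rewrite mulr1.
have [xi xiP] := choice disc.
have xih i : abs (x i - xi i) <= h * dvec abs x i.
  exact: le_trans (xiP i).2 (dW i).
(* A zero shared by the discs around x_i and x_j would give |x_i - x_j| <= 2 h |x_i - x_j|, against
   h < 1/2. *)
have xi_inj : injective xi.
  move=> i j xij; apply/eqP; apply/negPn/negP => ij.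
  have := absv_triangle Habs (xi i) (x i) (x j).
  have := xih j; rewrite -xij (absvB Habs (x j)); have := xih i.
  have : h * dvec abs x i <= h * abs (x i - x j).
    by rewrite ler_wpM2l// dvec_le.
  have : h * dvec abs x j <= h * abs (x i - x j).
    by rewrite ler_wpM2l// (absvB Habs (x i)) dvec_le// eq_sym.
  have : 2 * h * abs (x i - x j) < 1 * abs (x i - x j).
    by rewrite ltr_pM2r// (absv_gt0 Habs) subr_eq0 xinj.
  lra.
have rxi i := (xiP i).1.
exists xi; split=> //.
- move=> z; rewrite {1}(distinct_roots_factor Hdeg xi_inj rxi) hornerZ horner_prod.
  by congr (_ * _); apply: eq_bigr => i _; rewrite hornerXsubC.
- by move=> i; exact: (xiP i).2.
- move=> i j ij; split; first exact: xinj.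
  apply: le_trans (xiP j).2 _; rewrite /weierstrass_weight /v -mulrA ler_pM2l//.
  rewrite -mulrA ler_peMr ?(absv_ge0 Habs)// mulrC ler_pdivlMr ?dvec_gt0// mul1r.
  by rewrite (absvB Habs (x i)) dvec_le// eq_sym.
Qed.

End Semilocal.

(** * Convergence, order and error estimate of the iteration *)

Lemma pairwise_dist_bound (R : realType) (K : fieldType) (abs : K -> R) n (xi : 'I_n -> K) :
  is_absval abs -> (2 <= n)%N -> injective xi ->
  exists2 D : R, 0 < D & forall i j, i != j -> D <= abs (xi i - xi j).
Proof.
move=> Habs n2 xi_inj.
have xinj (i j : 'I_n) : i != j -> xi i != xi j by apply: contra_neq; exact: xi_inj.
exists (\big[Num.min/1]_(i < n) dvec abs xi i).
  by apply: lt_bigmin => // i _; exact: dvec_gt0.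
move=> i j ij; apply: le_trans (dvec_le abs xi n2 ij).
exact: bigmin_le.
Qed.

Theorem theorem3p2 (R : realType) (K : closedFieldType) (abs : K -> R)
  (Habs : is_absval abs) (f : {poly K}) (n : nat) (Hn : (2 <= n)%N)
  (Hdeg : size f = n.+1) (N : nat) (HN : (1 <= N)%N)
  (p : \bar R) (Hp : (1 <= p)%E) (x0 : 'I_n -> K)
  (Hdist : forall i j : 'I_n, i != j -> x0 i != x0 j) :
  let a := (n.-1)%:R `^ (1 - invp p) in
  let E := Ef abs p f in
  E x0 <= 1 / (1 + Num.sqrt a) ^+ 2 ->
  Omega n p a (E x0) < 2 ->
  (n = 2%N /\ p = +oo%E -> E x0 < 1 / (1 + Num.sqrt a) ^+ 2) ->
  [/\ forall z : K, root f z -> ~~ (('X - z%:P) ^+ 2 %| f),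
      forall k : nat, Dom f N (iterW f N x0 k)
    & exists xi : 'I_n -> K,
      [/\ root_vector f xi,
          vconverges abs (iterW f N x0) xi,
          conv_order abs (iterW f N x0) xi N.+1
        & forall k : nat,
            E (iterW f N x0 k) <= 1 / (1 + Num.sqrt a) ^+ 2 ->
            Omega n p a (E (iterW f N x0 k)) < 2 ->
            cle (cnorm abs (fun i => iterW f N x0 k i - xi i))
                (fun i => alphaf a (E (iterW f N x0 k)) * abs (Wcorr f (iterW f N x0 k) i))]].
Proof.
move=> a E t_le Om_lt _.
have f0 : f != 0 by rewrite -size_poly_gt0 Hdeg.
have [xi [xi_root xi_inj rxi _ cx]] := weierstrass_root_vector Habs Hn Hdeg Hp Hdist t_le Om_lt.
have wbnd := weierstrass_weight_bnd Habs Hn Hp Hdist t_le.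
have pw := prod_weierstrass_weight_le Habs Hn Hp Hdist t_le.
have tau1 := weierstrass_factor_ge1 Habs Hn Hp Hdist t_le.
have taulo := weierstrass_factor_lt Om_lt.
set tau := weierstrass_factor _ _ _ _ in pw tau1 taulo.
set h := hf _ _ in wbnd taulo.
set w := weierstrass_weight _ _ _ _ in cx wbnd pw.
have i0 : 'I_n := Ordinal (ltnW Hn).
have h0 : 0 <= h by case/andP: (wbnd i0); exact: le_trans.
case: N HN => // M _.
have ck k := close_iter Habs f0 xi_root wbnd pw tau1 h0 taulo M k cx.
split.
- by move=> z; exact: distinct_roots_simple Hdeg xi_inj rxi.
- by move=> k; apply: (close_Dom Habs f0 xi_root wbnd pw tau1 h0 taulo M.+1 (ck k)).
exists xi; split=> //.
- move=> eps eps0.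
  have q01 : 0 <= tau - 1 < 1.
    rewrite subr_ge0 tau1 ltrBlDr; apply: le_lt_trans taulo.
    by rewrite ler_peMl ?(le_trans ler01 tau1)// lerDl mulr_ge0.
  have e0 : 0 <= maxnorm abs (fun i => x0 i - xi i).
    exact: le_trans (absv_ge0 Habs _) (maxnorm_ge _ (fun i => x0 i - xi i) i0).
  have [k0 k0P] := geometric_lt q01 e0 eps0.
  exists k0 => k /k0P lt_eps i; apply: le_lt_trans lt_eps.
  apply: le_trans (close_iter_le Habs f0 xi_root wbnd pw tau1 h0 taulo M k i cx) _.
  rewrite ler_wpM2l ?exprn_ge0//; first by case/andP: q01.
  exact: (maxnorm_ge _ (fun i => x0 i - xi i)).
(* If D separates the zeros, all iterates keep their components at distance at least D / 2, so one
   constant serves for every k. *)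
- have [D D0 DP] := pairwise_dist_bound Habs Hn xi_inj.
  have D20 : 0 < D / 2 by rewrite divr_gt0.
  have [C C0 CP] :=
    Tmap_order Habs f0 xi_root wbnd pw tau1 h0 taulo M.+1 D20.
  have e0 k : 0 <= maxnorm abs (fun i => iterW f M.+1 x0 k i - xi i).
    exact: le_trans (absv_ge0 Habs _) (maxnorm_ge _ (fun i => iterW f M.+1 x0 k i - xi i) i0).
  exists C => k; apply/bigmax_leP; split; first by rewrite mulr_ge0 ?exprn_ge0.
  move=> i _; apply: CP (ck k) _ i => i j ij.
  have [le2 _ _] := close_roots_dist Habs wbnd tau1 h0 taulo (ck k) ij.
  by rewrite ler_pdivrMr// mulrC; exact: le_trans (DP i j ij) le2.
- move=> k tk_le Omk_lt i; set x := iterW f M.+1 x0 k in tk_le Omk_lt *.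
  have xk_inj (l j : 'I_n) : l != j -> x l != x j by move=> lj; case: (ck k l j lj).
  (* Restarting at x^(k) gives a root-vector xi' with the required bound; it remains to identify it
     with xi componentwise. *)
  have [xi' [_ _ rxi' err cx']] :=
    weierstrass_root_vector Habs Hn Hdeg Hp xk_inj tk_le Omk_lt.
  have wbnd' := weierstrass_weight_bnd Habs Hn Hp xk_inj tk_le.
  have tau1' := weierstrass_factor_ge1 Habs Hn Hp xk_inj tk_le.
  have taulo' := weierstrass_factor_lt Omk_lt.
  have h0' : 0 <= hf a (E x) by case/andP: (wbnd' i0); exact: le_trans.
  suff xiE : xi' i = xi i by rewrite /cnorm -xiE; exact: err.
  have : root f (xi' i) := rxi' i.
  rewrite rootE xi_root mulf_eq0 lead_coef_eq0 (negbTE f0)/=.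
  (* If xi'_i = xi_j with j <> i, this zero would be closer than |x_i - x_j| / 2 to both x_i and
     x_j. *)
  case/prodf_eq0 => j _; rewrite subr_eq0 => /eqP xij.
  have [ji|ji] := eqVneq j i; first by rewrite xij ji.
  have ij : i != j by rewrite eq_sym.
  have [_ _ lj] := close_roots_dist Habs wbnd tau1 h0 taulo (ck k) ij.
  have [_ li _] := close_roots_dist Habs wbnd' tau1' h0' taulo' cx' ij.
  have tri := absv_triangle Habs (xi j) (x i) (x j).
  suff : abs (x i - x j) < abs (x i - x j) by rewrite ltxx.
  apply: (le_lt_trans tri); rewrite xij in li; rewrite (absvB Habs (xi j)).
  by move: li lj; rewrite -/x; lra.
Qed.
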